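(* Consider the $(a:b)$ minimum-degree-$k$ Maker-Breaker game on $K_n$, and assume that Maker plays according to the Min-Deg-Strategy. (i) For every $\varepsilon>0$ and $k\in\mathbb N$ there is an $n_0(\varepsilon)\in\mathbb N$ such that for every $n\ge n_0(\varepsilon)$, Maker can build a spanning subgraph of $K_n$ with minimum degree at least $k=o(\ln n)$ if $a=o\left(\sqrt{\frac{n}{\ln n}}\right)$ and $b\le(1-\varepsilon)\frac{an}{a+\ln n}$. (ii) For every $\varepsilon>0$ and $k\in\mathbb N$ there is an $n_0(\varepsilon)\in\mathbb N$ such that for every $n\ge n_0(\varepsilon)$, Maker can build a spanning subgraph of $K_n$ with minimum degree at least $k$ if $a=\Omega\left(\sqrt{\frac{n}{\ln n}}\right)$, $k=o(a)$ and $b\le(1-\varepsilon)n$.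
   Context: The $(a:b)$ minimum-degree-$k$ Maker-Breaker game on $K_n$ ($n,a,b\in\mathbb N$, where $k=k(n)$ may depend on $n$): the board is the edge set of the complete graph $K_n$ on $n$ vertices. Breaker starts; in each round Breaker claims $b$ previously unclaimed edges and then Maker claims $a$ previously unclaimed edges. Maker wins if his edges contain a spanning subgraph of $K_n$ with minimum degree at least $k$; otherwise Breaker wins. At any moment of the game, for a vertex $v$, $d_M(v)$ and $d_B(v)$ denote the degree of $v$ in the graph formed by the edges claimed so far by Maker and by Breaker, respectively. The danger of $v$ is $\mathcal D(v)=d_B(v)-\frac{2b}{a}d_M(v)$. Min-Deg-Strategy: for $i\ge1$, Maker's $i$th move consists of $a$ steps. For every $1\le j\le a$, in the $j$th step of his $i$th move Maker chooses a vertex $v_i^{(j)}$ whose danger is maximal and claims an arbitrary not already taken edge incident with $v_i^{(j)}$.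
   Formalization: Part (ii) also assumes k=o(n), automatic if a=O(n); otherwise it fails, e.g. a=n^3, k=n^2. In the Min-Deg-Strategy the danger is maximised over vertices still incident with an unclaimed edge, so that the step is always possible. *)

(* Defs.v *)
From mathcomp Require Import all_boot all_order all_algebra.

Set Implicit Arguments.
Unset Strict Implicit.
Unset Printing Implicit Defensive.

Import Order.TTheory GRing.Theory Num.Theory.

Local Open Scope ring_scope.

Definition complete_edges (n : nat) : {set {set 'I_n}} :=
  [set e : {set 'I_n} | #|e| == 2%N].

Definition edge_degree (n : nat) (E : {set {set 'I_n}}) (v : 'I_n) : nat :=
  #|[set e in E | v \in e]|.

Record position (n : nat) := Position {
  maker_edges : {set {set 'I_n}};
  breaker_edges : {set {set 'I_n}}
}.

Definition start_position (n : nat) : position n :=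
  Position set0 set0.

Definition free_edges (n : nat) (p : position n) : {set {set 'I_n}} :=
  complete_edges n :\: (maker_edges p :|: breaker_edges p).

Definition maker_claims (n : nat) (p : position n) (e : {set 'I_n}) :
    position n :=
  Position (e |: maker_edges p) (breaker_edges p).

(* If fewer than b edges are left, Breaker claims all of them. *)
Definition breaker_move (n b : nat) (p q : position n) : Prop :=
  exists X : {set {set 'I_n}},
    [/\ X \subset free_edges p,
        #|X| = minn b #|free_edges p| &
        q = Position (maker_edges p) (breaker_edges p :|: X)].

(* A possibly non-deterministic strategy: [s p e] means that it allows Maker to
   claim the free edge e in position p. *)
Definition maker_strategy (n : nat) := position n -> {set 'I_n} -> Prop.

(* A move of Maker made of j steps; it stops early if the board is exhausted. *)
Inductive maker_move (n : nat) (s : maker_strategy n) :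
    nat -> position n -> position n -> Prop :=
| maker_move_done p : maker_move s 0 p p
| maker_move_exhausted j p :
    free_edges p = set0 -> maker_move s j p p
| maker_move_step j p e q :
    e \in free_edges p -> s p e ->
    maker_move s j (maker_claims p e) q -> maker_move s j.+1 p q.

(* The positions reached at the end of a round of the (a:b) game when Breaker
   plays arbitrarily and Maker plays according to s. *)
Inductive reachable (n a b : nat) (s : maker_strategy n) :
    position n -> Prop :=
| reachable_start : reachable a b s (start_position n)
| reachable_round p q r :
    reachable a b s p -> breaker_move b p q -> maker_move s a q r ->
    reachable a b s r.

Definition maker_wins (n k : nat) (p : position n) : Prop :=
  exists2 H : {set {set 'I_n}}, H \subset maker_edges p &
    forall v : 'I_n, (k <= edge_degree H v)%N.

(* The first conjunct says that s never leaves Maker without a legal step, so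
   that the second one, about all finished plays, is not satisfied for want of
   such plays. *)
Definition winning_strategy (n a b k : nat) (s : maker_strategy n) : Prop :=
  (forall p : position n, free_edges p != set0 ->
     exists2 e, e \in free_edges p & s p e) /\
  (forall p : position n, reachable a b s p ->
     free_edges p = set0 -> maker_wins k p).

Definition danger (n a b : nat) (p : position n) (v : 'I_n) : rat :=
  (edge_degree (breaker_edges p) v)%:R
  - (2 * b)%:R / a%:R * (edge_degree (maker_edges p) v)%:R.

Definition has_free_edge (n : nat) (p : position n) (v : 'I_n) : bool :=
  [exists e in free_edges p, v \in e].

(* The danger is maximised over the vertices at which an edge can still be
   claimed: a vertex of maximal danger among all vertices may have all its edges
   taken. The danger is re-evaluated before each step of a move, and both the
   choice of v among the maximisers and the choice of e are unrestricted. *)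
Definition min_deg_strategy (n a b : nat) : maker_strategy n := fun p e =>
  exists v : 'I_n,
    [/\ has_free_edge p v,
        forall w : 'I_n, has_free_edge p w -> danger a b p w <= danger a b p v,
        e \in free_edges p & v \in e].

Arguments min_deg_strategy : clear implicits.

(* Main.v *)
Require Import Defs.
From mathcomp Require Import all_boot all_order all_algebra.
From mathcomp Require Import ring lra.

Set Implicit Arguments.
Unset Strict Implicit.
Unset Printing Implicit Defensive.

Import Order.TTheory GRing.Theory Num.Theory.
Local Open Scope ring_scope.

(* For a set J of vertices that still have a free edge, follow the average danger
   of J backwards in time, adding to J each vertex that Maker chooses. A vertex
   of maximal danger does not lower the average when it is added, and a chosen
   vertex that already is in J lowers it by 2b/(a|J|) when its edge is claimed;
   so over one round, in which J grows to J', the average grows by at most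
   2b(|J'| - |J|)/(a|J'|). Summed up, this is 2b/a times a harmonic sum: twice
   what the theorem allows, because Breaker edges inside J count at both ends.
   While |J| <= m = n/D this loss is avoided by charging edges inside J
   separately, with weight 1/|J|; their number grows by at most |J'| for each
   added vertex, so they cost at most m in total. For m < |J| <= n the lossy
   estimate costs only O(D b/a). A vertex can thus have danger at most
   b + (b/a) ln n + n/D + O(D b/a + D) when it runs out of free edges, which is
   too small for a vertex of Maker degree below k. *)

Section Game.
Variables (n a b : nat).
Hypothesis a_gt0 : (0 < a)%N.

Let c : rat := (2 * b)%:R / a%:R.
Let bias_ge0 : 0 <= c. Proof. by rewrite divr_ge0. Qed.

Implicit Types (p q r : position n) (v w : 'I_n) (J : {set 'I_n}).

(** * Free edges, degrees and danger under a single claim *)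

Lemma free_edges_breaker p q : breaker_move b p q ->
  free_edges q \subset free_edges p.
Proof.
case=> X [sX _ ->]; apply/subsetP => e; rewrite !inE /= => /andP[+ ->].
by rewrite !negb_or andbT => /and3P[-> -> _].
Qed.

Lemma free_edges_maker p e : free_edges (maker_claims p e) \subset free_edges p.
Proof.
apply/subsetP => f; rewrite !inE /= => /andP[+ ->].
by rewrite !negb_or andbT => /andP[/andP[_ ->] ->].
Qed.

Lemma has_free_edgeS p q v : free_edges q \subset free_edges p ->
  has_free_edge q v -> has_free_edge p v.
Proof.
move=> sqp /existsP[e /andP[eq ve]]; apply/existsP; exists e.
by rewrite (subsetP sqp).
Qed.

Lemma edge_degreeS (E F : {set {set 'I_n}}) v : E \subset F ->
  (edge_degree E v <= edge_degree F v)%N.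
Proof.
move=> sEF; apply/subset_leq_card/subsetP => e; rewrite !inE.
by case/andP=> /(subsetP sEF) -> ->.
Qed.

Lemma edge_degreeU1 (E : {set {set 'I_n}}) e v : e \notin E -> v \in e ->
  edge_degree (e |: E) v = (edge_degree E v).+1.
Proof.
move=> eE ve; rewrite /edge_degree.
have -> : [set f in e |: E | v \in f] = e |: [set f in E | v \in f].
  by apply/setP => f; rewrite !inE; case: eqVneq => [->|//]; rewrite ve.
by rewrite cardsU1 inE (negPf eE).
Qed.

Lemma danger_maker p e v : danger a b (maker_claims p e) v <= danger a b p v.
Proof.
rewrite /danger /= lerD2l lerN2 ler_wpM2l ?bias_ge0 //.
by rewrite ler_nat edge_degreeS // subsetUr.
Qed.

Lemma danger_maker_incident p e v : e \in free_edges p -> v \in e ->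
  danger a b (maker_claims p e) v = danger a b p v - c.
Proof.
rewrite !inE negb_or => /andP[/andP[eM _] _] ve.
by rewrite /danger /= edge_degreeU1 // -natr1 /c; ring.
Qed.

Lemma danger_maker_move s j q r v : maker_move s j q r ->
  danger a b r v <= danger a b q v.
Proof.
elim=> [//|//|{}j p e {}q _ _ _ /le_trans]; apply; exact: danger_maker.
Qed.

Lemma maker_edges_move s j q r : maker_move s j q r ->
  maker_edges q \subset maker_edges r /\ breaker_edges r = breaker_edges q.
Proof.
elim=> [//|//|{}j p e {}q _ _ _ [sM ->]]; split=> //.
exact: subset_trans (subsetUr _ _) sM.
Qed.

(** * Maker's move and the average danger *)

Definition avg_danger p J : rat := (\sum_(v in J) danger a b p v) / #|J|%:R.

Lemma avg_danger1 p v : avg_danger p [set v] = danger a b p v.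
Proof. by rewrite /avg_danger big_set1 cards1 divr1. Qed.

(** Induction along the move, the set being enlarged from the last step back to the first. Of the
    [j] steps, [|J'| - |J|] add a vertex and each other one lowers the danger sum by [c]; dividing
    all these savings by the largest size [|J'|] only understates them. *)
Lemma maker_move_avg_danger j q r J : J != set0 ->
  maker_move (min_deg_strategy n a b) j q r ->
  (forall v, v \in J -> has_free_edge r v) ->
  exists2 J' : {set 'I_n},
    [/\ J \subset J', forall v, v \in J' -> has_free_edge q v &
        (#|J'| <= #|J| + j)%N] &
    avg_danger r J <=
      avg_danger q J' - c * (j%:R + #|J|%:R - #|J'|%:R) / #|J'|%:R.
Proof.
move=> J0; elim=> {j q r} [p Jfree|j p fp0 Jfree|j p e r ep sp _ IH Jfree].
- by exists J; rewrite ?addn0 //; rewrite add0r subrr mulr0 mul0r subr0.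
- have [v vJ] := set0Pn _ J0; have /existsP[e] := Jfree v vJ.
  by rewrite fp0 inE.
have [J1 [sJ1 J1free J1card] leJ1] := IH Jfree.
have {}J1free w : w \in J1 -> has_free_edge p w.
  by move/J1free; apply: has_free_edgeS; apply: free_edges_maker.
have J1gt0 : (0 < #|J1|)%N.
  by rewrite (leq_trans _ (subset_leq_card sJ1)) // card_gt0.
have J1n0 : (#|J1|%:R : rat) > 0 by rewrite ltr0n.
case: sp => v [vfree vmax _ ve].
have [vJ1|vJ1] := boolP (v \in J1).
  exists J1; first by rewrite addnS leqW.
  apply: le_trans leJ1 _.
  suff : avg_danger (maker_claims p e) J1 <= avg_danger p J1 - c / #|J1|%:R.
    rewrite -natr1 => H; apply: le_trans (lerB H (lexx _)) _.
    by rewrite le_eqVlt; apply/orP; left; apply/eqP; ring.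
  rewrite /avg_danger -mulrBl ler_pM2r ?invr_gt0 //.
  rewrite (bigD1 v) //= [in leRHS](bigD1 v) //= danger_maker_incident //.
  rewrite addrAC lerD2r lerD2l.
  by apply: ler_sum => w _; apply: danger_maker.
(* The vertex [v] is at least as dangerous as all of [J1], so adding it does not lower the average.
   The number of savings is unchanged; only their denominator grows. *)
exists (v |: J1).
  rewrite cardsU1 vJ1 add1n addnS ltnS; split => //.
    exact: subset_trans sJ1 (subsetUr _ _).
  by move=> w /setU1P[->|/J1free].
apply: le_trans leJ1 _; rewrite cardsU1 vJ1 add1n -!natr1.
apply: lerB; last first.
  rewrite (_ : j%:R + 1 + _ - _ = j%:R + #|J|%:R - #|J1|%:R); last by ring.
  apply: ler_wpM2l.
    by rewrite mulr_ge0 ?bias_ge0 // subr_ge0 addrC -natrD ler_nat.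
  by rewrite lef_pV2 ?posrE ?addr_gt0 // lerDl.
have le1 : \sum_(w in J1) danger a b (maker_claims p e) w <=
           \sum_(w in J1) danger a b p w.
  by apply: ler_sum => w _; apply: danger_maker.
have le2 : \sum_(w in J1) danger a b p w <= #|J1|%:R * danger a b p v.
  by rewrite mulr_natl -sumr_const; apply: ler_sum => w /J1free/vmax.
rewrite /avg_danger cardsU1 vJ1 add1n -natr1 big_setU1 //=.
rewrite ler_pdivrMr // mulrAC ler_pdivlMr ?addr_gt0 //.
by nra.
Qed.

(** * Breaker's move and the edges inside a set *)

(** A [position] may hold sets of any size; the size test makes counting by pairs valid in all
    positions and leaves nothing inside a singleton. *)
Definition breaker_inside p J : {set {set 'I_n}} :=
  [set e in breaker_edges p | (#|e| == 2%N) && (e \subset J)].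

(** Double counting of the incidences between [X] and [J]. *)
Lemma sum_edge_degree (X : {set {set 'I_n}}) J :
  (\sum_(v in J) edge_degree X v = \sum_(e in X) #|e :&: J|)%N.
Proof.
under eq_bigr do rewrite /edge_degree -sum1_card.
under [RHS]eq_bigr do rewrite -sum1_card.
rewrite (exchange_big_dep (mem X)) /=; last first.
  by move=> v e _; rewrite inE => /andP[].
apply: eq_bigr => e eX; apply: eq_bigl => v.
by rewrite !inE eX andbC.
Qed.

Lemma breaker_moveP p q : breaker_move b p q ->
  exists X : {set {set 'I_n}}, [/\ (#|X| <= b)%N, X \subset complete_edges n,
    [disjoint breaker_edges p & X], breaker_edges q = breaker_edges p :|: X &
    maker_edges q = maker_edges p].
Proof.
case=> X [sX cX ->]; exists X; rewrite cX geq_minl; split => //.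
  by apply: subset_trans sX _; rewrite subDset subsetUr.
rewrite disjoint_sym disjoints_subset; apply: subset_trans sX _.
by apply/subsetP => e; rewrite !inE negb_or => /andP[/andP[]].
Qed.

Lemma edge_degreeU (E X : {set {set 'I_n}}) v : [disjoint E & X] ->
  edge_degree (E :|: X) v = (edge_degree E v + edge_degree X v)%N.
Proof.
move=> dEX; rewrite /edge_degree -cardsUI [X in (_ + X)%N]eq_card0 ?addn0.
  by congr #|pred_of_set _|; apply/setP => e; rewrite !inE andb_orl.
move=> e; rewrite !inE; case eE: (e \in E) => //=.
by rewrite (disjointFr dEX) // andbF.
Qed.

(** A new edge [e] raises the sum by the size of [e :&: J], which is at most 2, and exceeds 1 only
    if [e] lies inside [J]. *)
Lemma breaker_move_sum_danger p q J : breaker_move b p q ->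
  \sum_(v in J) danger a b q v <= \sum_(v in J) danger a b p v + (2 * b)%:R /\
  \sum_(v in J) danger a b q v <= \sum_(v in J) danger a b p v + b%:R
    + #|breaker_inside q J|%:R - #|breaker_inside p J|%:R.
Proof.
case/breaker_moveP=> X [cX /subsetP sX dX qB qM].
have eqS : \sum_(v in J) danger a b q v =
    \sum_(v in J) danger a b p v + (\sum_(e in X) #|e :&: J|)%:R.
  rewrite -sum_edge_degree natr_sum -big_split /=; apply: eq_bigr => v _.
  by rewrite /danger qB qM edge_degreeU // natrD; ring.
have eX e : e \in X -> #|e| = 2%N by move/sX; rewrite inE => /eqP.
split; rewrite eqS.
  rewrite lerD2l ler_nat mulnC; apply: leq_trans (leq_mul cX (leqnn 2)).
  rewrite -sum_nat_const; apply: leq_sum => e /eX <-.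
  exact/subset_leq_card/subsetIl.
have -> : breaker_inside q J =
    breaker_inside p J :|: [set e in X | e \subset J].
  apply/setP => e; rewrite !inE qB inE andb_orl; congr orb.
  by case eXE: (e \in X) => //=; rewrite eX.
have -> : #|breaker_inside p J :|: [set e in X | e \subset J]| =
    (#|breaker_inside p J| + #|[set e in X | e \subset J]|)%N.
  rewrite -cardsUI [X in (_ + X)%N]eq_card0 ?addn0 // => e.
  rewrite !inE; case eE: (e \in breaker_edges p) => //=.
  by rewrite (disjointFr dX) // andbF.
rewrite natrD -!addrA lerD2l [_ + (_ - _)]addrC subrK -natrD ler_nat.
have -> : #|[set e in X | e \subset J]| = (\sum_(e in X) (e \subset J))%N.
  by rewrite -big_mkcondr /= -sum1_card; apply: eq_bigl => e; rewrite inE.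
apply: leq_trans (leq_add cX (leqnn _)).
rewrite -sum1_card -big_split /=; apply: leq_sum => e /eX e2.
have [/setIidPl -> | nsJ] := boolP (e \subset J); first by rewrite e2.
rewrite addn0 -ltnS -e2; apply: proper_card.
by rewrite properE subsetIl subsetI subxx.
Qed.

(** An edge inside [J'] but not inside [J] has one end in [J' :\: J] and the other in [J']; ordered
    pairs of this kind bound the increase. *)
Lemma breaker_insideS p J J' : J \subset J' ->
  (#|breaker_inside p J'| <=
     #|breaker_inside p J| + (#|J'| - #|J|) * #|J'|)%N.
Proof.
move=> sJ.
pose crossing := [set [set vw.1; vw.2] | vw in finset.setX (J' :\: J) J'].
have sub : breaker_inside p J' \subset breaker_inside p J :|: crossing.
  apply/subsetP => e; rewrite !inE => /and3P[-> /cards2P[x [y [xy ->]]]].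
  rewrite cards2 xy /= => /subsetP sxy.
  have [xJ' yJ'] : x \in J' /\ y \in J'.
    by split; apply: sxy; rewrite !inE eqxx ?orbT.
  have [xJ|xJ] := boolP (x \in J); last first.
    apply/orP; right; apply/imsetP; exists (x, y) => //.
    by rewrite !inE /= xJ xJ'.
  have [yJ|yJ] := boolP (y \in J); last first.
    apply/orP; right; apply/imsetP; exists (y, x).
      by rewrite !inE /= yJ yJ'.
    exact: setUC.
  apply/orP; left; apply/subsetP => z; rewrite !inE.
  by case/orP=> /eqP ->.
apply: leq_trans (subset_leq_card sub) _.
apply: leq_trans (leq_card_setU _ _) _; rewrite leq_add2l.
apply: leq_trans (leq_imset_card _ _) _.
by rewrite cardsX cardsD (setIidPr sJ).
Qed.

(** * Harmonic sums and the bound on the average danger over all rounds *)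

Definition harmonic_sum (j : nat) : rat := \sum_(0 <= i < j) i.+1%:R^-1.

Lemma harmonic_sumS j : harmonic_sum j.+1 = harmonic_sum j + j.+1%:R^-1.
Proof. by rewrite /harmonic_sum big_nat_recr. Qed.

Lemma harmonic_sumD_ge j s :
  s%:R / (j + s)%:R <= harmonic_sum (j + s) - harmonic_sum j.
Proof.
elim: s => [|s IH]; first by rewrite addn0 mul0r subrr.
rewrite addnS harmonic_sumS -natr1 mulrDl mul1r addrAC lerD2r.
apply: le_trans IH; have [/eqP|js] := posnP (j + s).
  by rewrite addn_eq0 => /andP[_ /eqP->]; rewrite !mul0r.
by rewrite ler_wpM2l ?ler0n // lef_pV2 ?posrE ?ltr0n // ler_nat.
Qed.

Lemma harmonic_sum_le i j : (i <= j)%N -> harmonic_sum i <= harmonic_sum j.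
Proof.
move/subnKC <-; rewrite -subr_ge0.
by apply: le_trans (harmonic_sumD_ge _ _); rewrite divr_ge0.
Qed.

(* The second case is used for |J| <= m; its term (2b)/m pays for the round in
   which |J| crosses m. *)
Definition danger_bound m p J : rat :=
  if (m < #|J|)%N then c * (harmonic_sum n - harmonic_sum #|J|)
  else c * (harmonic_sum n - harmonic_sum m) + (2 * b)%:R / m%:R
    + #|breaker_inside p J|%:R / #|J|%:R + (m%:R - #|J|%:R)
    + b%:R / a%:R * (harmonic_sum m - harmonic_sum #|J|).

(** Base case of the invariant, as every danger is 0 at the start. *)
Lemma danger_bound_ge0 m p J : (m <= n)%N -> 0 <= danger_bound m p J.
Proof.
move=> mn; have Jn : (#|J| <= n)%N by rewrite -[n in leqRHS]card_ord max_card.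
rewrite /danger_bound; case: ltnP => Jm.
  by rewrite mulr_ge0 ?bias_ge0 ?subr_ge0 ?harmonic_sum_le.
have JmR : (#|J|%:R : rat) <= m%:R by rewrite ler_nat.
have hJm := harmonic_sum_le Jm; have hmn := harmonic_sum_le mn.
have h1 : 0 <= c * (harmonic_sum n - harmonic_sum m).
  by apply: mulr_ge0 bias_ge0 _; rewrite subr_ge0.
have h2 : 0 <= b%:R / a%:R * (harmonic_sum m - harmonic_sum #|J|).
  by apply: mulr_ge0; [exact: divr_ge0 | rewrite subr_ge0].
have h3 : 0 <= (2 * b)%:R / m%:R :> rat by exact: divr_ge0.
have h4 : 0 <= #|breaker_inside p J|%:R / #|J|%:R :> rat by exact: divr_ge0.
lra.
Qed.

(** One round of the invariant, by the position of [m] relative to [|J|] and [|J'|]. Above [m], and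
    when [m] is crossed, each Breaker edge is charged twice; below [m], it is charged once and the
    edges inside [J'] are carried separately. *)
Lemma danger_bound_step m p q J J' : (0 < m)%N ->
  J != set0 -> J \subset J' -> (#|J'| <= #|J| + a)%N ->
  breaker_move b p q ->
  avg_danger p J' <= danger_bound m p J' ->
  avg_danger q J' - c * (a%:R + #|J|%:R - #|J'|%:R) / #|J'|%:R
    <= danger_bound m q J.
Proof.
move=> m0 J0 sJ cardJ' pq IH.
have [sum1 sum2] := breaker_move_sum_danger J' pq.
have insJ := breaker_insideS q sJ.
have J_gt0 : (0 < #|J|)%N by rewrite card_gt0.
have [s eJ'] : exists s, #|J'| = (#|J| + s)%N.
  by exists (#|J'| - #|J|)%N; rewrite subnKC // subset_leq_card.
have J'_gt0 : (0 < #|J'|)%N by rewrite eJ' addn_gt0 J_gt0.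
have hs := harmonic_sumD_ge #|J| s; rewrite -eJ' in hs.
have sa : (s <= a)%N by move: cardJ'; rewrite eJ' leq_add2l.
have eJ'R : #|J'|%:R = #|J|%:R + s%:R :> rat by rewrite eJ' natrD.
have a0 : (a%:R : rat) > 0 by rewrite ltr0n.
have saR : (s%:R : rat) <= a%:R by rewrite ler_nat.
have s0 : (s%:R : rat) >= 0 by rewrite ler0n.
have J'R : (#|J'|%:R : rat) > 0 by rewrite ltr0n.
have JR : (#|J|%:R : rat) > 0 by rewrite ltr0n.
have [t tE] : exists t : rat, b%:R / a%:R = t by exists (b%:R / a%:R).
have cE : c = 2 * t by rewrite /c natrM -mulrA tE.
have t0 : 0 <= t by rewrite -tE divr_ge0.
have bE : b%:R = t * a%:R by rewrite -tE divfK // gt_eqF.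
have tsJ : t * (s%:R / #|J'|%:R) <=
    t * (harmonic_sum #|J'| - harmonic_sum #|J|) by rewrite ler_wpM2l.
(* Since [2b = c a], Breaker's gain [2b/|J'|] less Maker's saving [c (a - s)/|J'|] leaves
   [c s/|J'|]. *)
have crude : avg_danger q J' - c * (a%:R + #|J|%:R - #|J'|%:R) / #|J'|%:R
    <= danger_bound m p J' + c * (s%:R / #|J'|%:R).
  apply: le_trans (lerD IH (lexx _)).
  rewrite /avg_danger !mulrA -mulrBl -mulrDl.
  rewrite ler_pM2r ?invr_gt0 //; move: sum1; rewrite eJ'R natrM bE cE.
  by set x := \sum_(v in J') _; set y := \sum_(v in J') _; lra.
have [Jm|Jm] := ltnP m #|J|.
  apply: le_trans crude _; rewrite /danger_bound Jm.
  rewrite (leq_trans Jm) ?eJ' ?leq_addr // -eJ'.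
  rewrite cE -!mulrA; lra.
have mJR : (#|J|%:R : rat) <= m%:R by rewrite ler_nat.
have hJm := harmonic_sum_le Jm.
have [J'm|J'm] := ltnP m #|J'|.
  apply: le_trans crude _; rewrite /danger_bound J'm ltnNge Jm /= tE.
  (* From [s <= a] and [m < |J'|]: the cost is at most [c a/m = 2b/m]. *)
  have h1 : c * (s%:R / #|J'|%:R) <= (2 * b)%:R / m%:R.
    rewrite mulrA natrM bE cE -!mulrA ler_pM2l // ler_wpM2l //.
    apply: ler_pM; rewrite ?invr_ge0 // lef_pV2 ?posrE ?ltr0n //.
    by rewrite ler_nat ltnW.
  have h2 := harmonic_sum_le (ltnW J'm).
  have h3 : c * (harmonic_sum n - harmonic_sum #|J'|) <=
            c * (harmonic_sum n - harmonic_sum m).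
    by rewrite ler_wpM2l ?bias_ge0 // lerB.
  have h4 : 0 <= t * (harmonic_sum m - harmonic_sum #|J|).
    by rewrite mulr_ge0 // subr_ge0.
  have h5 : 0 <= #|breaker_inside q J|%:R / #|J|%:R :> rat by rewrite divr_ge0.
  lra.
(* With [b] charged instead of [2b], the net cost before division is
   [b - c (a - s) = t (2s - a) <= t s]. *)
have {crude sum1} fine : 
    avg_danger q J' - c * (a%:R + #|J|%:R - #|J'|%:R) / #|J'|%:R
    <= avg_danger p J' + t * (s%:R / #|J'|%:R) 
       + #|breaker_inside q J'|%:R / #|J'|%:R
       - #|breaker_inside p J'|%:R / #|J'|%:R.
  rewrite /avg_danger !mulrA -!mulrBl -!mulrDl -mulrBl.
  rewrite ler_pM2r ?invr_gt0 //; move: sum2; rewrite eJ'R bE cE.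
  have : t * s%:R <= t * a%:R by rewrite ler_wpM2l.
  set x := \sum_(v in J') _; set y := \sum_(v in J') _; lra.
(* The [s] added vertices bring at most [s |J'|] inner edges, of total weight [s]; the term
   [m - |J|] of [danger_bound] pays for them. *)
have ins : #|breaker_inside q J'|%:R / #|J'|%:R <=
    #|breaker_inside q J|%:R / #|J|%:R + s%:R :> rat.
  rewrite -(ler_nat rat) in insJ.
  rewrite ler_pdivrMr // (le_trans insJ) // natrD natrM eJ' addKn mulrDl lerD2r.
  rewrite -eJ' -mulrA ler_peMr // mulrC ler_pdivlMr // mul1r ler_nat.
  exact: subset_leq_card.
apply: le_trans fine _; move: IH.
rewrite /danger_bound !ltnNge Jm J'm /= tE; lra.
Qed.

(** Induction on the rounds with [J] arbitrary: the previous round is entered with the enlarged set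
    [J'], whose vertices already had a free edge then. *)
Lemma reachable_avg_danger m p J : (0 < m <= n)%N ->
  reachable a b (min_deg_strategy n a b) p -> J != set0 ->
  (forall v, v \in J -> has_free_edge p v) ->
  avg_danger p J <= danger_bound m p J.
Proof.
move=> /andP[m0 mn] rp; elim: rp J => {p} [J J0 _|p q r _ IH pq qr J J0 Jfree].
  rewrite /avg_danger big1 ?mul0r ?danger_bound_ge0 // => v _.
  rewrite /danger /= /edge_degree (_ : [set _ in _ | _] = set0).
    by rewrite cards0 mulr0 subrr.
  by apply/setP => e; rewrite !inE.
have [J' [sJ J'free cardJ'] leJ'] := maker_move_avg_danger J0 qr Jfree.
apply: le_trans leJ' _.
have [_ rB] := maker_edges_move qr.
(* The bound depends on the position only through Breaker's edges. *)
have -> : danger_bound m r J = danger_bound m q J.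
  by rewrite /danger_bound /breaker_inside rB.
apply: (danger_bound_step m0 J0 sJ cardJ' pq); apply: IH.
  by apply: contraNneq J0 => J'0; rewrite -subset0 -J'0.
by move=> v /J'free; apply/has_free_edgeS/free_edges_breaker.
Qed.

(** * From bounded danger to Maker's win *)

Lemma danger_breaker_move p q v : breaker_move b p q ->
  danger a b q v <= danger a b p v + b%:R.
Proof.
(* No edge lies inside a singleton, so the gain is [b] and not [2b]. *)
move=> pq; have [_] := breaker_move_sum_danger [set v] pq.
rewrite !big_set1 => /le_trans; apply; rewrite -addrA gerDl subr_le0.
rewrite ler_nat (_ : breaker_inside q _ = set0) ?cards0 //.
apply/setP => e; rewrite !inE; apply/and3P => -[_ /eqP e2 /subset_leq_card].
by rewrite e2 cards1.
Qed.

Lemma card_complete_edges_at v : edge_degree (complete_edges n) v = n.-1.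
Proof.
have <- : #|[set [set v; w] | w in [set~ v]]| = n.-1.
  rewrite card_in_imset ?cardsC1 ?card_ord // => w w'; rewrite !inE => wv w'v.
  by move/setP/(_ w); rewrite !inE eqxx orbT (negPf wv) => /esym/eqP.
rewrite /edge_degree; congr #|pred_of_set _|; apply/setP => e; rewrite !inE.
apply/andP/imsetP => [[/cards2P[x [y [xy ->]]]]|[w]].
  rewrite !inE => /orP[/eqP vx|/eqP vy].
    by exists y; rewrite ?vx // !inE eq_sym.
  by exists x; rewrite ?vy 1?finset.setUC // !inE.
by rewrite !inE => wv ->; rewrite cards2 (eq_sym v) wv !inE eqxx.
Qed.

(** All [n - 1] edges at [v] are taken, so those that are not Maker's are Breaker's. *)
Lemma not_free_danger p v : ~~ has_free_edge p v ->
  n.-1%:R - (1 + c) * (edge_degree (maker_edges p) v)%:R <= danger a b p v.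
Proof.
move=> nfree; rewrite /danger -/c mulrDl mul1r opprD addrA lerD2r.
rewrite lerBlDr -natrD ler_nat -(card_complete_edges_at v) addnC.
apply: leq_trans (leq_card_setU _ _); apply/subset_leq_card/subsetP => e.
rewrite !inE => /andP[e2 ve]; rewrite ve !andbT.
apply: contraNT nfree => eMB; apply/existsP; exists e.
by rewrite !inE eMB e2.
Qed.

(** Consider the round in which [v] loses its last free edge. Before it, the invariant for [[set v]]
    bounds the danger of [v]; Breaker adds at most [b] and Maker adds nothing. A Maker degree below
    [k] would force a larger danger by [not_free_danger]. *)
Lemma min_deg_strategy_winning m k : (1 < n)%N -> (0 < m <= n)%N ->
  c * (harmonic_sum n - harmonic_sum m) + (2 * b)%:R / m%:R + m%:R
    + b%:R / a%:R * harmonic_sum m + b%:R + c * k%:R + k%:R < n%:R ->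
  winning_strategy a b k (min_deg_strategy n a b).
Proof.
move=> n1 mn lt_n; split=> [p /set0Pn[e ep]|p rp p0].
  have /cards2P[x [y [_ ee]]] : #|e| == 2%N.
    by move: ep; rewrite !inE => /andP[].
  have xfree : has_free_edge p x.
    by apply/existsP; exists e; rewrite ep ee !inE eqxx.
  have [v vfree vmax] :=
    @arg_maxP _ _ _ x (has_free_edge p) (danger a b p) xfree.
  by have /existsP[f /andP[fp vf]] := vfree; exists f => //; exists v; split.
(* Stated for any vertex out of free edges in any reachable position, so that induction on the
   rounds applies. *)
suff deg_ge v : ~~ has_free_edge p v -> (k <= edge_degree (maker_edges p) v)%N.
  exists (maker_edges p) => // v; apply: deg_ge.
  by apply/existsP => -[e]; rewrite p0 inE.
elim: rp => {p p0} [|p q r rp IH pq qr] nfree.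
  (* At the start the danger is 0, so a vertex without a free edge would give [n - 1 <= 0]. *)
  have := not_free_danger nfree.
  rewrite /danger /= /edge_degree (_ : [set _ in _ | _] = set0).
    by rewrite cards0 !mulr0 subr0 lern0; case: (n) n1 => [|[]].
  by apply/setP => e; rewrite !inE.
have [sM _] := maker_edges_move qr; have [X [_ _ _ _ qM]] := breaker_moveP pq.
have [vfree|/IH/leq_trans->//] := boolP (has_free_edge p v); last first.
  by apply: edge_degreeS; rewrite -qM.
rewrite leqNgt; apply/negP => degk.
have /(reachable_avg_danger mn rp) : [set v] != set0.
  by apply/set0Pn; exists v; rewrite inE.
rewrite avg_danger1 => bnd.
have {}bnd : danger a b p v <= danger_bound m p [set v].
  by apply: bnd => w; rewrite inE => /eqP ->.
have := not_free_danger nfree; have := danger_maker_move v qr.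
have := danger_breaker_move v pq; move: bnd.
have /andP[m0 _] := mn.
rewrite /danger_bound cards1 ltnNge m0 /=.
rewrite (_ : breaker_inside p _ = set0) ?cards0; last first.
  apply/setP => e; rewrite !inE; apply/and3P => -[_ /eqP e2 /subset_leq_card].
  by rewrite e2 cards1.
have -> : harmonic_sum 1 = 1 by rewrite /harmonic_sum big_nat1 invr1.
have nE : n%:R = n.-1%:R + 1 :> rat by rewrite natr1 prednK // ltnW.
(* A degree below [k] is at most [k - 1]; this unit makes up for [n - 1] in place of [n]. *)
have dk : (edge_degree (maker_edges r) v)%:R + 1 <= k%:R :> rat.
  by rewrite natr1 ler_nat.
have : c * (edge_degree (maker_edges r) v)%:R <= c * k%:R.
  by rewrite ler_wpM2l ?bias_ge0 // ler_nat ltnW.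
have t0 : 0 <= b%:R / a%:R :> rat by rewrite divr_ge0.
rewrite nE in lt_n; lra.
Qed.

End Game.

(* Real estimates for harmonic sums and logarithms *)
From mathcomp Require Import all_classical all_reals all_analysis.
Import numFieldNormedType.Exports.
Local Open Scope classical_set_scope.

Lemma harmonic_sumD_le m j : (0 < m)%N ->
  harmonic_sum (m + j) - harmonic_sum m <= j%:R / m%:R.
Proof.
move=> m0; elim: j => [|j IH]; first by rewrite addn0 subrr mul0r.
rewrite addnS harmonic_sumS -[j.+1%:R]natr1 mulrDl mul1r addrAC lerD //.
by rewrite lef_pV2 ?posrE ?ltr0n // ler_nat ltnW // ltnS leq_addr.
Qed.

(** A new term satisfies [1/(j+1) <= ln (j+1) - ln j], by [ln (1 + x) <= x] at [x = -1/(j+1)]. *)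
Lemma ratr_harmonic_sum_le (R : realType) j : (0 < j)%N ->
  ratr (harmonic_sum j) <= 1 + ln j%:R :> R.
Proof.
elim: j => // -[_ _|j IH _].
  by rewrite harmonic_sumS /harmonic_sum big_nil add0r invr1 ln1 rmorph1 addr0.
rewrite harmonic_sumS rmorphD /= fmorphV /= ratr_nat.
have j0 : (0 : R) < j.+1%:R by rewrite ltr0n.
have j1 : (0 : R) < j.+2%:R by rewrite ltr0n.
have hlt : j.+2%:R^-1 < (1 : R) by rewrite invf_lt1 // ltr1n.
have := @le_ln1Dx R (- j.+2%:R^-1); rewrite ltrN2 hlt => /(_ isT).
have -> : 1 - j.+2%:R^-1 = j.+1%:R / j.+2%:R :> R.
  by rewrite -[j.+1%:R](addrK 1) natr1 mulrBl mul1r divff ?gt_eqF.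
rewrite ln_div ?posrE //; have := IH isT.
by move: (ratr _) (ln j.+1%:R) (ln j.+2%:R) (_^-1) => h l l' i; lra.
Qed.

(** With [s] the fourth root of [x], [ln x = 4 ln s <= 4 s]. *)
Lemma ln_cube_le (R : realType) (x : R) : 1 <= x ->
  ln x ^+ 3 <= 64 * Num.sqrt (Num.sqrt x) ^+ 3.
Proof.
move=> x1; have x0 : 0 < x by lra.
set s := Num.sqrt _.
have s0 : 0 < s by rewrite !sqrtr_gt0.
have xE : x = s ^+ 4.
  by rewrite (exprM s 2 2) !sqr_sqrtr ?sqrtr_ge0 // ltW.
have l0 : 0 <= ln x by rewrite ln_ge0.
have l4 : ln x <= 4 * s.
  rewrite xE lnXn // -(mulr_natl (ln s)) ler_pM2l //.
  exact/ltW/ln_sublinear.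
rewrite (_ : 64 * s ^+ 3 = (4 * s) ^+ 3); last by ring.
by rewrite lerXn2r ?nnegrE // mulr_ge0 // ltW.
Qed.

Lemma near_infty_ge_ln (R : realType) (M : R) :
  \forall n \near \oo, M <= ln n%:R.
Proof.
near=> n.
have hn : expR M <= n%:R by near: n; exact: nbhs_infty_ger.
by rewrite -(expRK M) ler_ln ?posrE ?expR_gt0 // (lt_le_trans (expR_gt0 M)).
Unshelve. all: by end_near. Qed.

(** For large [a] this turns a lower bound of order [sqrt (n / ln n)] on [a] into [ln n = o(a)]. *)
Lemma near_infty_ln_cube_le (R : realType) (M : R) : 0 < M ->
  \forall n \near \oo, ln n%:R ^+ 3 <= M * n%:R :> R.
Proof.
move=> M0; near=> n.
have n1 : (1 : R) <= n%:R by near: n; exact: nbhs_infty_ger.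
have hn : (64 / M) ^+ 4 <= n%:R by near: n; exact: nbhs_infty_ger.
apply: le_trans (@ln_cube_le R _ n1) _.
set s := Num.sqrt _.
have s0 : 0 < s by rewrite !sqrtr_gt0; lra.
have nE : n%:R = s ^+ 4 by rewrite (exprM s 2 2) !sqr_sqrtr ?sqrtr_ge0.
have : 64 / M <= s.
  have := hn; by rewrite nE ler_pXn2r // nnegrE ?divr_ge0 // ltW.
rewrite ler_pdivrMr // nE => hs.
rewrite (_ : M * s ^+ 4 = s * M * s ^+ 3); last by ring.
by apply: ler_wpM2r hs; rewrite exprn_ge0 // ltW.
Unshelve. all: by end_near. Qed.

(** The choice [m = n %/ D]: the harmonic tail is at most [n/m <= 2D], the head at most [1 + ln n],
    and [2b/m <= 4D]. *)
Lemma min_deg_strategy_winning_real (R : realType) (n a b k D : nat) :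
  (0 < a)%N -> (1 < n)%N -> (b <= n)%N -> (0 < D <= n)%N ->
  b%:R + n%:R / D%:R + b%:R / a%:R * (1 + ln n%:R + 4 * D%:R + 2 * k%:R)
    + 4 * D%:R + k%:R < n%:R :> R ->
  winning_strategy a b k (min_deg_strategy n a b).
Proof.
move=> a0 n1 bn /andP[D0 Dn] lt_n.
have m0 : (0 < n %/ D)%N by rewrite divn_gt0.
have mn : (n %/ D <= n)%N by exact: leq_div.
apply: (min_deg_strategy_winning a0 n1 (m := n %/ D)); first by rewrite m0.
rewrite -(ltr_rat R).
have mD : (n %/ D)%:R <= n%:R / D%:R :> R.
  by rewrite ler_pdivlMr ?ltr0n // -natrM ler_nat leq_divM.
(* From [n < (m + 1) D] and [m >= 1]. *)
have nm : n%:R <= 2 * D%:R * (n %/ D)%:R :> R.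
  rewrite -!natrM ler_nat; apply: leq_trans (ltnW (ltn_ceil n D0)) _.
  rewrite mulSn mulnC (mulnC 2) -mulnA mul2n -addnn mulnDr leq_add2r.
  by rewrite leq_pmulr.
set m := (n %/ D)%N in m0 mn mD nm *.
have mR : (0 : R) < m%:R by rewrite ltr0n.
have tail : ratr (harmonic_sum n - harmonic_sum m) <= 2 * D%:R :> R.
  have : harmonic_sum n - harmonic_sum m <= n%:R / m%:R.
    have := harmonic_sumD_le (n - m) m0; rewrite subnKC // => /le_trans.
    by apply; rewrite ler_pM2r ?invr_gt0 ?ltr0n // ler_nat leq_subr.
  rewrite -(ler_rat R) => /le_trans; apply.
  by rewrite fmorph_div /= !ratr_nat ler_pdivrMr.
have head : ratr (harmonic_sum m) <= 1 + ln n%:R :> R.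
  apply: le_trans (ratr_harmonic_sum_le R m0) _.
  by rewrite lerD2l ler_ln ?posrE ?ltr0n ?(leq_trans m0) // ler_nat.
have twob : (2 * b)%:R / m%:R <= 4 * D%:R :> R.
  rewrite ler_pdivrMr // natrM.
  have : (b%:R : R) <= n%:R by rewrite ler_nat.
  lra.
have [t tE] : exists t : R, b%:R / a%:R = t by exists (b%:R / a%:R).
have t0 : 0 <= t by rewrite -tE divr_ge0.
rewrite tE in lt_n.
have ht := ler_wpM2l t0 tail; have hh := ler_wpM2l t0 head.
rewrite !(rmorphD, rmorphM, rmorphB, fmorphV, rmorphN) /= !ratr_nat in ht hh *.
rewrite (_ : b%:R + (b%:R + 0) = 2 * b%:R); last by ring.
rewrite -!(mulrA 2) tE; rewrite natrM -mulrA in twob.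
move: (ratr _) (ratr _) (ln _) (b%:R / m%:R) (n%:R / D%:R)
  tail head twob ht hh lt_n mD.
move=> *; lra.
Qed.

(** Common core of both regimes. The real [D] in the last hypothesis stands for a constant [4D]
    fixed inside the proof, which is eventually negligible against [ln n]; [n0] does not depend on
    [b]. *)
Lemma near_min_deg_strategy_winning (R : realType) (eps : R)
    (k a : nat -> nat) :
  0 < eps -> (forall n, (0 < a n)%N) ->
  (\forall n \near \oo, (k n)%:R <= eps / 16 * n%:R) ->
  exists n0 : nat, forall n b : nat, (n0 <= n)%N ->
    (b%:R : R) <= n%:R ->
    (forall D : R, D <= eps / 16 * ln n%:R ->
     b%:R / (a n)%:R * (1 + ln n%:R + D + 2 * (k n)%:R) <=
     (1 - eps / 2) * n%:R - b%:R) ->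
    winning_strategy (a n) b (k n) (min_deg_strategy n (a n) b).
Proof.
move=> eps0 a0 hk.
(* Then [n/D <= eps n/4]; with [4D] and [k] at most [eps n/16] each, the total stays below the slack
   [eps n/2]. *)
have [D De] : exists D : nat, 4 / eps <= D%:R :> R.
  exists (Num.bound (4 / eps)).
  by apply/ltW/archi_boundP; rewrite divr_ge0 // ltW.
have D0 : (0 < D)%N.
  by rewrite -(ltr_nat R); apply: lt_le_trans De; rewrite divr_gt0.
suff [N _ HN] : \forall n \near \oo, forall b : nat, (b%:R : R) <= n%:R ->
    (forall D : R, D <= eps / 16 * ln n%:R ->
     b%:R / (a n)%:R * (1 + ln n%:R + D + 2 * (k n)%:R) <=
     (1 - eps / 2) * n%:R - b%:R) ->
    winning_strategy (a n) b (k n) (min_deg_strategy n (a n) b).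
  by exists N => n b /HN; apply.
near=> n => b bn hb.
have kn : (k n)%:R <= eps / 16 * n%:R by near: n.
have Dn : (4 * D%:R) <= eps / 16 * n%:R.
  rewrite -ler_pdivrMl ?divr_gt0 //.
  by near: n; exact: nbhs_infty_ger.
have Dln : (4 * D%:R) <= eps / 16 * ln n%:R.
  rewrite -ler_pdivrMl ?divr_gt0 //.
  by near: n; exact: near_infty_ge_ln.
have n1 : (1 < n)%N by near: n; exists 2%N.
have n0 : (0 : R) < n%:R by rewrite ltr0n ltnW.
apply: (@min_deg_strategy_winning_real R _ _ _ _ D) => //.
- by rewrite -(ler_nat R).
- by rewrite D0; near: n; exists D.
have := hb _ Dln.
have nD : n%:R / D%:R <= eps / 4 * n%:R.
  rewrite ler_pdivrMr ?ltr0n // mulrAC ler_peMl ?(ltW n0) //.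
  by move: De; rewrite ler_pdivrMr // => ?; lra.
move: (n%:R / D%:R) nD (_ / _ * _) => x nD y; nra.
Unshelve. all: by end_near. Qed.

(** * The two regimes of [a] *)

Theorem theorem7 (R : realType) :
  (forall (eps : R) (k a : nat -> nat),
     0 < eps ->
     (forall n, (0 < a n)%N) ->
     (fun n => (k n)%:R : R) =o_\oo (fun n => ln n%:R) ->
     (fun n => (a n)%:R : R) =o_\oo (fun n => Num.sqrt (n%:R / ln n%:R)) ->
     exists n0 : nat, forall n b : nat, (n0 <= n)%N ->
       b%:R <= (1 - eps) * ((a n)%:R * n%:R / ((a n)%:R + ln n%:R)) ->
       winning_strategy (a n) b (k n) (min_deg_strategy n (a n) b))
  /\
  (forall (eps : R) (k a : nat -> nat),
     0 < eps ->
     (forall n, (0 < a n)%N) ->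
     (fun n => (a n)%:R : R) =Omega_\oo (fun n => Num.sqrt (n%:R / ln n%:R)) ->
     (fun n => (k n)%:R : R) =o_\oo (fun n => (a n)%:R : R) ->
     (fun n => (k n)%:R : R) =o_\oo (fun n => n%:R : R) ->
     exists n0 : nat, forall n b : nat, (n0 <= n)%N ->
       b%:R <= (1 - eps) * n%:R ->
       winning_strategy (a n) b (k n) (min_deg_strategy n (a n) b)).
Proof.
split=> eps k a eps0 a0.
- move=> /eqoP ko _.
  have e16 : 0 < eps / 16 by rewrite divr_gt0.
  have kln : \forall n \near \oo, (k n)%:R <= eps / 16 * ln n%:R :> R.
    near=> n; have n1 : (0 < n)%N by near: n; exists 1%N.
    have : `|(k n)%:R : R| <= eps / 16 * `|ln n%:R : R|.
      by near: n; exact: ko _ e16.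
    by rewrite normr_nat (ger0_norm (ln_ge0 _)) // ler1n.
  have [|n0 win] := @near_min_deg_strategy_winning R eps k a eps0 a0.
    near=> n; have n1 : (0 < n)%N by near: n; exists 1%N.
    have /le_trans : (k n)%:R <= eps / 16 * ln n%:R by near: n.
    apply; rewrite ler_pM2l //; apply/ltW/ln_sublinear; by rewrite ltr0n.
  suff [N _ HN] : \forall n \near \oo, forall b : nat,
      b%:R <= (1 - eps) * ((a n)%:R * n%:R / ((a n)%:R + ln n%:R)) ->
      (n0 <= n)%N ->
      winning_strategy (a n) b (k n) (min_deg_strategy n (a n) b).
    exists (maxn N n0) => n b; rewrite geq_max => /andP[Nn n0n] hb.
    exact: HN.
  near=> n => b hb n0n.
  have kn : (k n)%:R <= eps / 16 * ln n%:R by near: n.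
  have ln1 : 16 / eps <= ln n%:R by near: n; exact: near_infty_ge_ln.
  have n_gt0 : (0 : R) < n%:R by rewrite ltr0n; near: n; exists 1%N.
  have an : (0 : R) < (a n)%:R by rewrite ltr0n.
  rewrite ler_pdivrMr // mulrC in ln1.
  have lnn : (0 : R) < ln n%:R.
    by rewrite -(pmulr_rgt0 _ eps0); lra.
  have [t tE] : exists t : R, b%:R / (a n)%:R = t by exists (b%:R / (a n)%:R).
  have t0 : 0 <= t by rewrite -tE divr_ge0.
  have bE : b%:R = t * (a n)%:R by rewrite -tE divfK // gt_eqF.
  (* The bias condition with its denominator cleared and a factor [a] cancelled, where [t = b/a]. *)
  have {}hb : t * (a n)%:R + t * ln n%:R <= (1 - eps) * n%:R.
    move: hb; rewrite mulrA ler_pdivlMr ?addr_gt0 // bE.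
    rewrite (_ : t * _ * _ = (a n)%:R * (t * (a n)%:R + t * ln n%:R));
      last by ring.
    rewrite (_ : (1 - eps) * _ = (a n)%:R * ((1 - eps) * n%:R)); last by ring.
    by rewrite ler_pM2l.
  have epsn : 0 <= eps * n%:R by rewrite mulr_ge0 // ltW.
  have ta : 0 <= t * (a n)%:R by rewrite mulr_ge0 // ltW.
  have tl : 0 <= t * ln n%:R by rewrite mulr_ge0 // ltW.
  apply: win => // [|D hD]; rewrite ?tE bE; first lra.
  (* The terms 1 and [D] are at most [eps/16 * ln n] each, and [2k] is at most twice that. *)
  have h1 : t * (1 + D + 2 * (k n)%:R) <= t * (eps / 4 * ln n%:R).
    by rewrite ler_wpM2l //; lra.
  have h2 : eps / 4 * (t * ln n%:R) <= eps / 4 * n%:R.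
    by apply: ler_wpM2l; lra.
  lra.
- move=> aO /eqoP ka /eqoP kn.
  have e16 : 0 < eps / 16 by rewrite divr_gt0.
  have /eqO_exP [C C0 aC] : (fun n => Num.sqrt (n%:R / ln n%:R) : R) =O_\oo
      (fun n => (a n)%:R : R).
    by rewrite -eqOmegaO -eqOmegaE.
  have [|n0 win] := @near_min_deg_strategy_winning R eps k a eps0 a0.
    near=> n.
    have : `|(k n)%:R : R| <= eps / 16 * `|n%:R : R|.
      by near: n; exact: kn _ e16.
    by rewrite !normr_nat.
  suff [N _ HN] : \forall n \near \oo, forall b : nat,
      b%:R <= (1 - eps) * n%:R ->
      (n0 <= n)%N ->
      winning_strategy (a n) b (k n) (min_deg_strategy n (a n) b).
    exists (maxn N n0) => n b; rewrite geq_max => /andP[Nn n0n] hb.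
    exact: HN.
  near=> n => b hb n0n.
  have kan : (k n)%:R <= eps / 16 * (a n)%:R.
    have : `|(k n)%:R : R| <= eps / 16 * `|(a n)%:R : R|.
      by near: n; exact: ka _ e16.
    by rewrite !normr_nat.
  have ln1 : 16 / eps <= ln n%:R by near: n; exact: near_infty_ge_ln.
  have n_gt0 : (0 : R) < n%:R by rewrite ltr0n; near: n; exists 1%N.
  have an : (0 : R) < (a n)%:R by rewrite ltr0n.
  rewrite ler_pdivrMr // mulrC in ln1.
  have lnn : (0 : R) < ln n%:R.
    by rewrite -(pmulr_rgt0 _ eps0); lra.
  (* As [sqrt (n / ln n) <= C a], it is enough that [(16 C/eps)^2 (ln n)^3 <= n]. *)
  have lna : ln n%:R <= eps / 16 * (a n)%:R.
    have aCn : Num.sqrt (n%:R / ln n%:R) <= C * (a n)%:R.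
      have : `|Num.sqrt (n%:R / ln n%:R)| <= C * `|(a n)%:R : R| by near: n.
      by rewrite normr_nat ger0_norm // sqrtr_ge0.
    rewrite -ler_pdivrMl // -(ler_pM2l C0); apply: le_trans aCn.
    rewrite -[leLHS]ger0_norm; last first.
      by apply/ltW; rewrite !mulr_gt0 ?invr_gt0.
    rewrite -sqrtr_sqr.
    apply: ler_wsqrtr; rewrite ler_pdivlMr //.
    have : ln n%:R ^+ 3 <= (C * (eps / 16)^-1) ^- 2 * n%:R :> R.
      near: n; apply: near_infty_ln_cube_le.
      by rewrite invr_gt0 exprn_gt0 // mulr_gt0 ?invr_gt0.
    rewrite ler_pdivlMl ?exprn_gt0 ?mulr_gt0 ?invr_gt0 //.
    by congr (_ <= _); ring.
  (* The bias [b] is nonnegative, so a larger [eps] contradicts [hb]. *)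
  have eps1 : eps <= 1.
    have : 0 <= (1 - eps) * n%:R by apply: le_trans hb.
    by rewrite pmulr_lge0 // subr_ge0.
  have [t tE] : exists t : R, b%:R / (a n)%:R = t by exists (b%:R / (a n)%:R).
  have t0 : 0 <= t by rewrite -tE divr_ge0.
  have bE : b%:R = t * (a n)%:R by rewrite -tE divfK // gt_eqF.
  have epsn : 0 <= eps * n%:R by rewrite mulr_ge0 // ltW.
  have eln : eps * ln n%:R <= ln n%:R by rewrite ler_piMl // ltW.
  apply: win => // [|D hD]; first lra.
  rewrite ?tE bE; rewrite bE in hb.
  (* Here even [ln n] is small against [a], so the whole bracket is at most [eps/4 * a]. *)
  have h1 : t * (1 + ln n%:R + D + 2 * (k n)%:R) <= t * (eps / 4 * (a n)%:R).
    by rewrite ler_wpM2l //; lra.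
  have h2 : eps / 4 * (t * (a n)%:R) <= eps / 4 * n%:R.
    by apply: ler_wpM2l; lra.
  lra.
Unshelve. all: by end_near. Qed.
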